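(* Let $(W,d)$ be a complete separable metric space, let $\mathfrak{N}$ and $\widetilde{\mathfrak{N}}$ be compact subsets of $\mathfrak{M}_1(W)$, and let $V\subset W$ be a Borel subset such that $\eta(V)=1$ for every $\eta\in\mathfrak{N}$. Then the correspondence $g\mapsto g_*$ induces a uniformly continuous map from the space $\mathscr{B}_{\widetilde{\mathfrak{N}}}(\mathfrak{N}\times V,W)$, endowed with the distance $d(g_1,g_2)$ of convergence in probability uniform in $\eta\in\mathfrak{N}$, to the space $\mathscr{B}(\mathfrak{N},\widetilde{\mathfrak{N}})$, endowed with the Tchebycheff uniform metric with respect to the Lévy–Prokhorov metric.
   Context: $\mathfrak{M}_1(W)$ is the space of Borel probability measures on $W$ with the weak topology (convergence of integrals of bounded continuous functions). This topology is induced by the Lévy–Prokhorov metric $d_{\mathrm{LP}}$: $d_{\mathrm{LP}}(\eta_1,\eta_2)\le\varepsilon$ if and only if for every closed $K\subset W$, with $K_\varepsilon=\{w\in W: d(w,K)\le\varepsilon\}$, one has $\eta_1(K)\le\eta_2(K_\varepsilon)+\varepsilon$ and $\eta_2(K)\le\eta_1(K_\varepsilon)+\varepsilon$. $\mathscr{B}(\mathfrak{N}\times V,W)$ is the space of Borel maps $g:\mathfrak{N}\times V\to W$. It is endowed with the distance $$d(g_1,g_2)=\sum_{l=1}^\infty 2^{-l}\,\frac{\sup_{\eta\in\mathfrak{N}}\eta(\{w\in V: d(g_1(\eta,w),g_2(\eta,w))>2^{-l}\})}{1+\sup_{\eta\in\mathfrak{N}}\eta(\{w\in V: d(g_1(\eta,w),g_2(\eta,w))>2^{-l}\})},$$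 which induces the topology with subbasis the sets $U(g_0,\varepsilon,\delta)=\{g:\ \eta(\{w: d(g(\eta,w),g_0(\eta,w))>\varepsilon\})<\delta\text{ for all }\eta\in\mathfrak{N}\}$, $\varepsilon,\delta>0$. Each $g\in\mathscr{B}(\mathfrak{N}\times V,W)$ induces a Borel map $g_*:\mathfrak{N}\to\mathfrak{M}_1(W)$, $g_*\eta=(g(\eta,\cdot))_*\eta$, i.e. $\int_W\varphi\,d(g_*\eta)=\int_W\varphi(g(\eta,w))\,d\eta(w)$ for all bounded continuous $\varphi:W\to\mathbb{C}$. $\mathscr{B}_{\widetilde{\mathfrak{N}}}(\mathfrak{N}\times V,W)$ is the subspace of those $g$ with $g_*(\mathfrak{N})\subset\widetilde{\mathfrak{N}}$. $\mathscr{B}(\mathfrak{N},\widetilde{\mathfrak{N}})$ is the space of Borel maps $h:\mathfrak{N}\to\mathfrak{M}_1(W)$ with $h(\mathfrak{N})\subset\widetilde{\mathfrak{N}}$, with the Tchebycheff uniform metric $\sup_{\eta\in\mathfrak{N}}d_{\mathrm{LP}}(h(\eta),h'(\eta))$. *)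

(* Defs.v *)
From HB Require Import structures.
From mathcomp Require Import all_boot all_order all_algebra.
From mathcomp Require Import all_classical all_reals all_analysis.

Set Implicit Arguments.
Unset Strict Implicit.
Unset Printing Implicit Defensive.
Import Order.TTheory GRing.Theory Num.Theory.
Import numFieldNormedType.Exports.

Local Open Scope classical_set_scope.
Local Open Scope ring_scope.

(* As the library's [completeType] and [measurableType], this is pointed. *)
#[short(type="completeMetricType")]
HB.structure Definition CompleteMetric (R : numDomainType) :=
  {T of Complete T & Metric R T}.

Definition separable (T : topologicalType) :=
  exists2 D : set T, countable D & dense D.

(* Borel sets and maps are phrased with [<<s _ >>] directly because
   [measurableType] requires a point, whereas the subspaces on which Borel maps
   are considered below may be empty. *)
Definition borel_set (T : topologicalType) : set (set T) := <<s @open T >>.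

Definition borel_fun (T U : topologicalType) (f : T -> U) :=
  forall B, borel_set B -> borel_set (f @^-1` B).

Record borel_map (T U : topologicalType) := BorelMap {
  borel_map_fun :> T -> U ;
  borel_mapP : borel_fun borel_map_fun }.

Notation borelType W := (g_sigma_algebraType (@open W)).

Section borel_lemmas.
Context {T U : topologicalType}.

Lemma sigma_algebra_borel : sigma_algebra [set: T] (@borel_set T).
Proof. exact: smallest_sigma_algebra. Qed.

Lemma borel_setC (A : set T) : borel_set A -> borel_set (~` A).
Proof.
by case: sigma_algebra_borel => _ + _ => /[apply]; rewrite setTD.
Qed.

Lemma borel_bigcup (F : (set T)^nat) :
  (forall i, borel_set (F i)) -> borel_set (\bigcup_i F i).
Proof. by case: sigma_algebra_borel => _ _; exact. Qed.

Lemma borel_setU (A B : set T) :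
  borel_set A -> borel_set B -> borel_set (A `|` B).
Proof.
move=> bA bB; rewrite -bigcup2E; apply: borel_bigcup => -[|[|n]]//=.
by case: sigma_algebra_borel.
Qed.

Lemma borel_setI (A B : set T) :
  borel_set A -> borel_set B -> borel_set (A `&` B).
Proof.
move=> bA bB; rewrite -[A `&` B]setCK setCI.
by apply: borel_setC; apply: borel_setU; exact: borel_setC.
Qed.

Lemma continuous_borel (f : T -> U) : continuous f -> borel_fun f.
Proof.
move=> cf B; apply: (@smallest_sub _ _ _ [set C | borel_set (f @^-1` C)]).
- split=> [|A bA|F bF] /=.
  + by rewrite preimage_set0; case: sigma_algebra_borel.
  + by rewrite setTD preimage_setC; exact: borel_setC.
  + by rewrite preimage_bigcup; exact: borel_bigcup.
- move=> Q oQ /=; apply: sub_sigma_algebra.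
  by move/continuousP : cf; exact.
Qed.

Lemma borel_image_val (V : set T) (B : set V) :
  borel_set V -> borel_set B -> borel_set (set_val @` B).
Proof.
move=> bV; move: B.
apply: (@smallest_sub _ _ _ [set C : set V | borel_set (set_val @` C)]).
- split=> [|A bA|F bF] /=.
  + by rewrite image_set0; case: sigma_algebra_borel.
  + rewrite setTD.
    rewrite [X in borel_set X](_ : _ = V `&` ~` (set_val @` A)).
      by apply: borel_setI => //; exact: borel_setC.
    apply/seteqP; split=> [_ [v nAv <-]|w [Vw nAw]].
      split; first exact: set_valP.
      by move=> [v' Av' /val_inj vv']; apply: nAv; rewrite -vv'.
    exists (exist _ w (mem_set Vw)) => // Aw; apply: nAw.
    by exists (exist _ w (mem_set Vw)).
  + by rewrite image_bigcup; exact: borel_bigcup.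
- move=> _ [Q oQ <-] /=.
  rewrite [X in borel_set X](_ : _ = V `&` Q).
    by apply: borel_setI => //; exact: sub_sigma_algebra.
  apply/seteqP; split=> [_ [v Qv <-]|w [Vw Qw]].
    by split; first exact: set_valP.
  by exists (exist _ w (mem_set Vw)).
Qed.

End borel_lemmas.

Section borel_probabilities.
Context {R : realType} (W : completeMetricType R).

(* A library measure on [W] is defined on all sets; fixing its value outside the
   Borel sets makes equality in [borel_prob] the equality of Borel measures
   (lemma [borel_prob_eqP]). *)
Record borel_prob := BorelProb {
  borel_prob_val :> probability (borelType W) R ;
  borel_prob_out :
    forall A : set W, ~ borel_set A -> borel_prob_val A = 0%E }.

Lemma borel_prob_eqP (mu nu : borel_prob) :
  mu = nu <-> forall A : set W, borel_set A -> mu A = nu A.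
Proof.
split=> [->//|]; case: mu nu => [mu mu0] [nu nu0] /= munu.
have emunu : mu = nu :> (set W -> \bar R).
  apply/funext => A; have [bA|nbA] := pselect (borel_set A); first exact: munu.
  by rewrite mu0// nu0.
have {}emunu : mu = nu :> probability _ _.
  move: mu nu {mu0 nu0 munu} emunu.
  move=> [mu [[p1 p2] [p3] [p4] [p5] [p6] [p7] [p8]]].
  move=> [nu [[q1 q2] [q3] [q4] [q5] [q6] [q7] [q8]]] /= munu.
  subst nu.
  rewrite (Prop_irrelevance q1 p1) (Prop_irrelevance q2 p2) in q3 *.
  rewrite (Prop_irrelevance q3 p3) (Prop_irrelevance q4 p4).
  rewrite (Prop_irrelevance q5 p5) (Prop_irrelevance q6 p6).
  by rewrite (Prop_irrelevance q7 p7) (Prop_irrelevance q8 p8).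
by subst nu; congr BorelProb; exact: Prop_irrelevance.
Qed.

HB.instance Definition _ := gen_eqMixin borel_prob.
HB.instance Definition _ := gen_choiceMixin borel_prob.

Record bounded_continuous := BoundedContinuous {
  bc_fun :> W -> R ;
  bc_bounded : exists M : R, forall w, `|bc_fun w| <= M ;
  bc_continuous : continuous bc_fun }.

Definition bc_integral (mu : borel_prob) : {ptws bounded_continuous -> R} :=
  fun phi => \int[mu]_w phi w.

(* The weak topology: the coarsest one making all [mu |-> \int[mu]_w phi w]
   continuous, [phi] bounded and continuous. *)
HB.instance Definition _ :=
  Topological.copy borel_prob (initial_topology bc_integral).

(* The infimum is taken in [\bar R], so that the distance to the empty set is
   [+oo] and the thickening of the empty set is empty. *)
Definition thickening (K : set W) (e : R) : set W :=
  [set w | (ereal_inf [set (mdist w k)%:E | k in K] <= e%:E)%E].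

Definition LPdist (mu nu : borel_prob) : R :=
  inf [set e | 0 <= e /\ forall K : set W, closed K ->
         (mu K <= nu (thickening K e) + e%:E)%E /\
         (nu K <= mu (thickening K e) + e%:E)%E].

End borel_probabilities.

Section pushforward.
Context {R : realType} {W : completeMetricType R}.
Context (N : set (borel_prob W)) (V : set W).
Hypothesis bV : borel_set V.
Hypothesis NV : forall eta, N eta -> eta V = 1%E.
Variables (g : borel_map (N * V)%type W) (eta : N).

(* A subset of [V] is measured by [eta] through its image in [W]. *)
Definition push_fun (A : set (borelType W)) : \bar R :=
  if `[< borel_set A >] then
    set_val eta (set_val @` [set v : V | (A : set W) (g (eta, v))])
  else 0%E.

Let push_borel (A : set W) : borel_set A ->
  borel_set (set_val @` [set v : V | A (g (eta, v))]).
Proof.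
move=> bA; apply: borel_image_val => //.
have cv : continuous (fun v : V => (eta, v)).
  move=> v; apply: (@cvg_pair _ _ _ (nbhs v) (nbhs eta) (nbhs v)) => /=; last exact: cvg_id.
  exact: (@cvg_cst N eta V (nbhs v)).
exact: (continuous_borel cv (borel_mapP g bA)).
Qed.

Let push0 : push_fun set0 = 0%E.
Proof.
rewrite /push_fun; case: ifP => // _.
rewrite (_ : [set v | _] = set0) ?image_set0 ?measure0//.
Qed.

Let push_ge0 A : (0 <= push_fun A)%E.
Proof. by rewrite /push_fun; case: ifP. Qed.

Let push_sigma_additive :
  semi_sigma_additive push_fun.
Proof.
move=> F mF tF mUF.
have bF i : borel_set (F i : set W) by exact: mF.
have pushE i : push_fun (F i) =
    set_val eta (set_val @` [set v : V | F i (g (eta, v))]).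
  by rewrite /push_fun asboolT.
rewrite {2}/push_fun asboolT//.
rewrite (_ : [set v : V | _] = \bigcup_i [set v : V | F i (g (eta, v))])//.
rewrite image_bigcup.
under [X in X @ _ --> _]eq_fun do under eq_bigr do rewrite pushE.
apply: measure_semi_sigma_additive.
- by move=> i; exact: push_borel.
- apply/trivIsetP => i j _ _ ij; move/trivIsetP : tF => /(_ i j I I ij) Fij.
  rewrite -subset0 => _ [[v Fiv <-] [v' Fjv /val_inj vv']].
  suff : (F i `&` F j) (g (eta, v)) by rewrite Fij.
  by split => //; rewrite -vv'.
- by apply: borel_bigcup => i; exact: push_borel.
Qed.

HB.instance Definition _ := isMeasure.Build _ (borelType W) R
  push_fun push0 push_ge0 push_sigma_additive.

Let push_setT : push_fun setT = 1%E.
Proof.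
rewrite /push_fun asboolT; last exact: (@measurableT _ (borelType W)).
rewrite -(NV (set_valP eta)); congr (_ _).
apply/seteqP; split=> [_ [v _ <-]|w Vw]; first exact: set_valP.
by exists (exist _ w (mem_set Vw)).
Qed.

HB.instance Definition _ :=
  Measure_isProbability.Build _ (borelType W) R push_fun push_setT.

Let push_out (A : set W) : ~ borel_set A -> push_fun A = 0%E.
Proof. by move=> nbA; rewrite /push_fun asboolF. Qed.

Definition push : borel_prob W := BorelProb push_out.

End pushforward.

Section spaces.
Context {R : realType} {W : completeMetricType R}.
Context (N : set (borel_prob W)) (N' : set (borel_prob W)) (V : set W).
Hypothesis bV : borel_set V.
Hypothesis NV : forall eta, N eta -> eta V = 1%E.

Definition sup_deviation (g1 g2 : borel_map (N * V)%type W) (e : R) : R :=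
  sup [set fine (set_val eta
        (set_val @` [set v : V | e < mdist (g1 (eta, v)) (g2 (eta, v))]))
      | eta in [set: N]].

(* Not a pseudometric: the triangle inequality only holds up to a factor 2, as
   {d(g1,g3) > 2^-l} is covered by the deviations at level 2^-(l+1). *)
Definition prob_dist (g1 g2 : borel_map (N * V)%type W) : R :=
  \big[+%R/0]_(1 <= l <oo) (2 ^- l *
    (sup_deviation g1 g2 (2 ^- l) / (1 + sup_deviation g1 g2 (2 ^- l)))).

Definition borel_map_push :=
  {g : borel_map (N * V)%type W | forall eta, N' (push bV NV g eta)}.

Definition borel_map_prob :=
  {h : borel_map N (borel_prob W) | forall eta, N' (h eta)}.

Definition LP_unif_dist (h h' : borel_map N (borel_prob W)) : R :=
  sup [set LPdist (h eta) (h' eta) | eta in [set: N]].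

End spaces.

(* Main.v *)
(** If [d (g1, g2) <= e] outside a set of [eta]-measure at most [r], [e <= r],
    then [eta (g1 \in K) <= eta (g2 \in K_r) + r], so the pushforwards are at
    Levy-Prokhorov distance at most [r]; uniformity in [eta] is immediate.

    The work is in the Borel measurability of [g_* : N -> M_1(W)] for the weak
    topology. For [B] Borel, [eta |-> g_* eta (B)] is the [eta]-measure of a
    section of a Borel subset of [N * V], and [W] being second countable such a
    set is in the product sigma-algebra, so this function is Borel. The
    bounded continuous functions that approximate the indicators of finite
    intersections of balls form a countable family which separates the
    probability measures; hence a compact set of measures is a countable
    intersection of finite unions of half-spaces [int phi < q] or
    [int phi > q], and its preimage under [g_*] is Borel. As [g_*] takes its
    values in the compact set [N'], this suffices for the preimages of open
    sets. *)

Require Import Defs.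
From HB Require Import structures.
From mathcomp Require Import all_boot all_order all_algebra.
From mathcomp Require Import all_classical all_reals all_analysis.
From mathcomp Require Import measurable_realfun lra.

Set Implicit Arguments.
Unset Strict Implicit.
Unset Printing Implicit Defensive.
Import Order.TTheory GRing.Theory Num.Theory.
Import numFieldNormedType.Exports.

Local Open Scope classical_set_scope.
Local Open Scope ring_scope.

(** * Dense sequences, a countable base of balls, and bump functions *)

Lemma mdist_continuousl (R : realType) (W : metricType R) (a : W) :
  continuous (fun w : W => mdist w a).
Proof.
move=> w; apply/cvgrPdist_lt => e e0.
near=> x; have : ball w e x by near: x; exact: nbhsx_ballx.
rewrite ballEmdist /= => wx.
have := metric_triangle w x a; have := metric_triangle x w a.
rewrite (metric_sym x w) => h1 h2.
by rewrite ltr_norml; apply/andP; split; lra.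
Unshelve. all: by end_near. Qed.

Lemma separable_dense_seq (R : realType) (W : completeMetricType R) :
  separable W ->
  exists a : nat -> W, forall w r, 0 < r -> exists i, mdist w (a i) < r.
Proof.
move=> [D /pfcard_geP[D0|[a]] dD].
  (* [W] is pointed, so a dense set meets [setT] and cannot be empty. *)
  have [w [_]] := dD setT (ex_intro _ point I) openT.
  by rewrite D0.
exists a => w r r0.
have [||x [wx Dx]] := dD (ball w r)^°.
- by exists w; exact: nbhsx_ballx.
- exact: open_interior.
have [i _ ax] := 'surj_a Dx.
exists i; rewrite ax; move/interior_subset : wx.
by rewrite ballEmdist.
Qed.

Section dense_seq.
Context {R : realType} {W : completeMetricType R}.
Variable a : nat -> W.
Hypothesis dense_a : forall w r, 0 < r -> exists i, mdist w (a i) < r.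

Definition basic_ball (p : nat * nat) : set W :=
  [set w | mdist w (a p.1) < p.2.+1%:R^-1].

Lemma open_basic_ball p : open (basic_ball p).
Proof.
have -> : basic_ball p = (fun w : W => mdist w (a p.1)) @^-1` [set r | r < p.2.+1%:R^-1] by [].
by apply: open_comp => [w _|]; [exact: mdist_continuousl|exact: open_lt].
Qed.

Lemma nbhs_basic_ball (w : W) (A : set W) : nbhs w A ->
  exists2 p, basic_ball p w & basic_ball p `<=` A.
Proof.
move=> /nbhs_ballP[e /= e0 eA].
have e20 : 0 < e / 2 by rewrite divr_gt0.
(* With a radius below [e / 2], two points of the same ball are less than [e] apart. *)
have [n _ /(_ n (leqnn _)) /= ne] := near_infty_natSinv_lt (PosNum e20).
have [i wi] := @dense_a w n.+1%:R^-1 ltac:(by rewrite invr_gt0).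
exists (i, n) => // x /= xi; apply: eA; rewrite ballEmdist /=.
have := metric_triangle w (a i) x; rewrite (metric_sym (a i)).
move: xi; rewrite /basic_ball /= => xi tri.
by rewrite (le_lt_trans tri)// (splitr e) ltrD// (lt_trans _ ne).
Qed.

(** Finite intersections are indexed by lists, which gives a countable pi-system; the empty list
    yields the whole space. *)
Definition basic_box (s : seq (nat * nat)) : set W :=
  [set w | forall p, p \in s -> basic_ball p w].

Lemma basic_box_cons p s : basic_box (p :: s) = basic_ball p `&` basic_box s.
Proof.
apply/seteqP; split=> [w ws|w [wp ws] q].
  split; first by apply: ws; rewrite mem_head.
  by move=> q qs; apply: ws; rewrite in_cons qs orbT.
by rewrite in_cons => /predU1P[->//|/ws].
Qed.

Lemma basic_box_nil : basic_box [::] = setT.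
Proof. by apply/seteqP; split. Qed.

Lemma basic_box_cat s t : basic_box (s ++ t) = basic_box s `&` basic_box t.
Proof.
elim: s => [|p s ih]; first by rewrite basic_box_nil setTI.
by rewrite cat_cons !basic_box_cons ih setIA.
Qed.

Lemma open_basic_box s : open (basic_box s).
Proof.
elim: s => [|p s ih]; first by rewrite basic_box_nil; exact: openT.
by rewrite basic_box_cons; apply: openI => //; exact: open_basic_ball.
Qed.

Lemma setI_closed_basic_box : setI_closed (range basic_box).
Proof.
by move=> _ _ [s _ <-] [t _ <-]; exists (s ++ t); rewrite ?basic_box_cat.
Qed.

(** An open set is the union of the countably many basic balls it contains. *)
Lemma borel_set_basic_box : @borel_set W = <<s range basic_box >>.
Proof.
apply/seteqP; split.
  apply: smallest_sub; first exact: smallest_sigma_algebra.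
  move=> A oA.
  pose D := [set p | basic_ball p `<=` A].
  have -> : A = \bigcup_p (if p \in D then basic_box [:: p] else set0).
    apply/seteqP; split=> [w Aw|w [p _]].
      have [p wp pA] := nbhs_basic_ball (open_nbhs_nbhs (conj oA Aw)).
      exists p => //; rewrite mem_set//.
      by rewrite basic_box_cons basic_box_nil setIT.
    case: ifPn => // /set_mem pA; rewrite basic_box_cons basic_box_nil setIT.
    exact: pA.
  apply: (@countable_bigcupT_measurable _ (g_sigma_algebraType (range basic_box))) => // p.
  case: ifPn => _; last exact: measurable0.
  by apply: sub_sigma_algebra; exists [:: p].
apply: smallest_sub; first exact: smallest_sigma_algebra.
by move=> _ [s _ <-]; apply: sub_sigma_algebra; exact: open_basic_box.
Qed.

Lemma borel_prob_eq_basic_box (mu nu : borel_prob W) :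
  (forall s, mu (basic_box s) = nu (basic_box s)) -> mu = nu.
Proof.
move=> munu; apply/borel_prob_eqP => A bA.
apply: (@measure_unique _ R (borelType W) (range basic_box) (fun=> setT)) => //.
- exact: borel_set_basic_box.
- exact: setI_closed_basic_box.
- by move=> _; exists [::]; rewrite ?basic_box_nil.
- by rewrite bigcup_const.
- by move=> _ [s _ <-]; exact: munu.
- by move=> _; apply: fin_num_fun_lty; exact: fin_num_measure.
Qed.

(* Increases to the indicator of [basic_ball p] as [n] grows. *)
Definition bump n (p : nat * nat) (w : W) : R :=
  Num.min 1 (n%:R * Num.max 0 (p.2.+1%:R^-1 - mdist w (a p.1))).

Lemma bump_ge0 n p w : 0 <= bump n p w.
Proof. by rewrite /bump le_min ler01 mulr_ge0// le_max lexx. Qed.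

Lemma bump_le1 n p w : bump n p w <= 1.
Proof. by rewrite /bump ge_min lexx. Qed.

Lemma bump_continuous n p : continuous (bump n p).
Proof.
move=> w; apply: (@continuous_min R W (cst 1)
  (fun x => n%:R * Num.max 0 (p.2.+1%:R^-1 - mdist x (a p.1)))).
  exact: cvg_cst.
apply: (@continuousM R W (cst n%:R)); first exact: cvg_cst.
apply: (@continuous_max R W (cst 0)); first exact: cvg_cst.
apply: (@continuousB R R W (cst p.2.+1%:R^-1)); first exact: cvg_cst.
exact: mdist_continuousl.
Qed.

(** The sequence is eventually constant: inside the ball the gap is positive and [n] times it
    exceeds 1 in the end, outside the inner maximum is 0. *)
Lemma bump_cvg p w : bump n p w @[n --> \oo] --> (\1_(basic_ball p) w : R).
Proof.
rewrite indicE; have [/set_mem wp|/negP wp] := boolP (w \in basic_ball p).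
  have d0 : 0 < p.2.+1%:R^-1 - mdist w (a p.1) by rewrite subr_gt0.
  apply: cvg_near_cst; near=> n.
  rewrite /bump max_r ?ltW// min_l// -ler_pdivrMr// mul1r.
  by near: n; exact: nbhs_infty_ger.
apply: cvg_near_cst; near=> n.
rewrite /bump max_l ?mulr0 ?min_r// subr_le0 leNgt; apply/negP => wp'.
by apply: wp; exact/mem_set.
Unshelve. all: by end_near. Qed.

Definition box_bump n s (w : W) : R := \prod_(p <- s) bump n p w.

Lemma box_bump01 n s w : 0 <= box_bump n s w <= 1.
Proof.
rewrite /box_bump; elim: s => [|p s ih]; first by rewrite big_nil ler01 lexx.
rewrite big_cons; case/andP : ih => ih0 ih1.
by rewrite mulr_ge0 ?bump_ge0// mulr_ile1 ?bump_ge0 ?bump_le1.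
Qed.

Lemma box_bump_continuous n s : continuous (box_bump n s).
Proof.
rewrite /box_bump; elim: s => [|p s ih] w.
  by under [X in continuous_at _ X]eq_fun do rewrite big_nil; exact: cvg_cst.
under [X in continuous_at _ X]eq_fun do rewrite big_cons.
by apply: continuousM; [exact: bump_continuous|exact: ih].
Qed.

Lemma box_bump_cvg s w :
  box_bump n s w @[n --> \oo] --> (\1_(basic_box s) w : R).
Proof.
elim: s => [|p s ih].
  rewrite basic_box_nil indicT; under eq_fun do rewrite /box_bump big_nil.
  exact: cvg_cst.
rewrite basic_box_cons indicI /=; under eq_fun do rewrite /box_bump big_cons.
by apply: cvgM; [exact: bump_cvg|exact: ih].
Qed.

Lemma box_bump_bounded n s : exists M : R, forall w, `|box_bump n s w| <= M.
Proof.
by exists 1 => w; have /andP[? ?] := box_bump01 n s w; rewrite ger0_norm.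
Qed.

Definition box_test n s : bounded_continuous W :=
  BoundedContinuous (box_bump_bounded n s) (box_bump_continuous (n := n) (s := s)).

End dense_seq.

Lemma continuous_borel_measurable (R : realType) (T : ptopologicalType) (f : T -> R) :
  continuous f -> measurable_fun [set: borelType T] f.
Proof.
move=> /continuousP cf; apply: (measurability (@measurable_realfun.RGenOpens.G R)).
  exact: measurable_realfun.RGenOpens.measurableE.
move=> _ [_ [x [y ->]] <-]; rewrite setTI.
by apply: sub_sigma_algebra; apply: cf; exact: interval_open.
Qed.

(** * Probability kernels built from setwise measurable families *)

Section kernels.
Context {R : realType} {W : completeMetricType R}.
Context d (T : measurableType d) (k : T -> borel_prob W).
Hypothesis mk : forall B : set W, borel_set B ->
  measurable_fun [set: T] (fun t => k t B).

Let kk (t : T) : {measure set (borelType W) -> \bar R} := k t.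

HB.instance Definition _ := @isKernel.Build _ _ T (borelType W) R kk mk.

Let kk1 t : kk t setT = 1%E. Proof. exact: probability_setT. Qed.

HB.instance Definition _ :=
  @Kernel_isProbability.Build _ _ T (borelType W) R kk kk1.

Lemma measurable_prob_xsection (A : set (T * borelType W)) : measurable A ->
  measurable_fun [set: T] (fun t => k t (xsection A t)).
Proof.
move=> mA; apply: (@measurable_fun_xsection_finite_kernel _ _ T (borelType W) R kk).
exact/mem_set.
Qed.

(** Integration against a kernel is applied to nonnegative functions; the box tests are of this
    kind. *)
Lemma measurable_bc_integral (phi : bounded_continuous W) :
  (forall w, 0 <= phi w) ->
  measurable_fun [set: T] (fun t => bc_integral (k t) phi).
Proof.
move=> phi0.
have mphi : measurable_fun [set: T * borelType W] (fun x => (phi x.2)%:E).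
  apply/measurable_EFinP.
  apply: (measurableT_comp (continuous_borel_measurable (@bc_continuous _ _ phi))).
  exact: measurable_snd.
have := @measurable_fun_integral_finite_kernel _ _ T (borelType W) R
  (fun x => (phi x.2)%:E) kk (fun x => phi0 x.2) mphi.
move=> mint; apply: (measurableT_comp _ mint).
exact: fine_measurable.
Qed.

End kernels.

(** * Test integrals as approximations of the measures of boxes *)

Section test_integrals.
Context {R : realType} {W : completeMetricType R}.
Variable a : nat -> W.

(** Dominated convergence: the products of bumps tend pointwise to the indicator of the box and are
    bounded by the constant 1, which is integrable for a probability. *)
Lemma bc_integral_box_test_cvg (mu : borel_prob W) s :
  (bc_integral mu (box_test a n s))%:E @[n --> \oo] --> mu (basic_box a s).
Proof.
have mbox : measurable (basic_box a s : set (borelType W)).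
  by apply: sub_sigma_algebra; exact: open_basic_box.
have mf n : measurable_fun [set: borelType W] (box_bump a n s).
  by apply: continuous_borel_measurable; exact: box_bump_continuous.
have [] := @dominated_convergence _ (borelType W) R mu setT measurableT
  (fun n w => (box_bump a n s w)%:E) (fun w => (\1_(basic_box a s) w)%:E)
  (cst 1%E).
- by move=> n; apply/measurable_EFinP.
- by apply/measurable_EFinP; exact: measurable_indic.
- by apply: aeW => w _; apply: cvg_EFin; [near=> n|exact: box_bump_cvg].
- by apply: finite_measure_integrable_cst.
- apply: aeW => w n _; rewrite lee_fin.
  by have /andP[? ?] := box_bump01 a n s w; rewrite ger0_norm.
move=> _ _; rewrite integral_indic// setIT.
apply: cvg_trans; apply: near_eq_cvg; near=> n.
rewrite /bc_integral /= fineK//; apply: integrable_fin_num => //.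
apply: (@le_integrable _ (borelType W) R mu setT measurableT _ (cst 1%E)).
- by apply/measurable_EFinP.
- move=> w _; rewrite lee_fin normr1.
  by have /andP[? ?] := box_bump01 a n s w; rewrite ger0_norm.
- by apply: finite_measure_integrable_cst.
Unshelve. all: by end_near. Qed.

End test_integrals.

(** * Weakly compact sets of measures and their preimages *)

Section weak_topology.
Context {R : realType} {W : completeMetricType R}.

Lemma bc_integral_continuous (phi : bounded_continuous W) :
  continuous (fun mu : borel_prob W => bc_integral mu phi).
Proof.
move=> mu.
apply: (@continuous_comp _ _ _ (@bc_integral R W) (fun g => g phi)).
  exact: initial_continuous.
exact: (@proj_continuous {classic bounded_continuous W} (fun=> R) phi).
Qed.

Variable a : nat -> W.
Hypothesis dense_a : forall w r, 0 < r -> exists i, mdist w (a i) < r.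

(** The test integrals determine the measures of all boxes in the limit, and the boxes form a
    generating pi-system. *)
Lemma borel_prob_separated (mu nu : borel_prob W) :
  (forall n s, bc_integral mu (box_test a n s) = bc_integral nu (box_test a n s)) ->
  mu = nu.
Proof.
move=> munu; apply: (borel_prob_eq_basic_box dense_a) => s.
have mus := @bc_integral_box_test_cvg _ _ a mu s.
have nus := @bc_integral_box_test_cvg _ _ a nu s.
rewrite -(cvg_lim (@ereal_hausdorff R) mus) -(cvg_lim (@ereal_hausdorff R) nus).
by under eq_fun do rewrite munu.
Qed.

(** Rational thresholds keep the family countable; the boolean selects the side of the threshold. *)
Definition half_space (i : (nat * seq (nat * nat)) * (rat * bool)) : set (borel_prob W) :=
  let I mu := bc_integral mu (box_test a i.1.1 i.1.2) in
  if i.2.2 then [set mu | I mu < ratr i.2.1] else [set mu | ratr i.2.1 < I mu].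

Lemma open_half_space i : open (half_space i).
Proof.
case: i => -[n s] [q []]; rewrite /half_space /=.
  apply: (@open_comp _ _ (fun mu => bc_integral mu (box_test a n s)) [set r | r < ratr q]).
    by move=> mu _; exact: bc_integral_continuous.
  exact: open_lt.
apply: (@open_comp _ _ (fun mu => bc_integral mu (box_test a n s)) [set r | ratr q < r]).
  by move=> mu _; exact: bc_integral_continuous.
exact: open_gt.
Qed.

Lemma half_space_separation (mu nu : borel_prob W) : mu <> nu ->
  exists i, half_space i nu /\ ~ half_space i mu.
Proof.
move=> munu.
have [n [s ne]] : exists n s,
    bc_integral mu (box_test a n s) <> bc_integral nu (box_test a n s).
  apply: contrapT => h; apply: munu; apply: borel_prob_separated => n s.
  by apply: contrapT => ne; apply: h; exists n, s.
have [lt|lt|//] := ltgtP (bc_integral mu (box_test a n s)) (bc_integral nu (box_test a n s)).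
  have [q] := rat_in_itvoo lt; rewrite in_itv /= => /andP[h1 h2].
  exists ((n, s), (q, false)); split=> //; rewrite /half_space /=.
  by apply/negP; rewrite -leNgt ltW.
have [q] := rat_in_itvoo lt; rewrite in_itv /= => /andP[h1 h2].
exists ((n, s), (q, true)); split=> //; rewrite /half_space /=.
by apply/negP; rewrite -leNgt ltW.
Qed.

Definition half_space_union (l : seq ((nat * seq (nat * nat)) * (rat * bool))) :
  set (borel_prob W) := [set mu | exists2 i, i \in l & half_space i mu].

(** Each point of [K] differs from [mu], so the open half-spaces that miss [mu] cover [K]; a finite
    subcover still misses [mu]. *)
Lemma compact_half_space_union (K : set (borel_prob W)) : compact K ->
  forall mu, ~ K mu ->
    exists l, K `<=` half_space_union l /\ ~ half_space_union l mu.
Proof.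
move=> cK mu nKmu.
(* The covering characterization of compactness is used on a pointed type; [mu] serves as the
   point. *)
pose P : ptopologicalType := HB.pack (borel_prob W) (isPointed.Build (borel_prob W) mu).
have {}cK : @compact P K := cK.
rewrite compact_cover in cK.
have [||D DN KD] := cK _ [set i | ~ half_space i mu] half_space.
- by move=> i _; exact: open_half_space.
- move=> nu Knu.
  have [|i [inu imu]] := @half_space_separation mu nu; last by exists i.
  by move=> munu; apply: nKmu; rewrite munu.
exists (finmap.enum_fset D); split.
  by move=> nu /KD[i iD inu]; exists i.
by move=> [i iD imu]; have /set_mem := DN i iD; exact.
Qed.

Lemma measurable_preimage_compact d (T : measurableType d) (h : T -> borel_prob W)
    (K : set (borel_prob W)) :
  (forall B : set W, borel_set B -> measurable_fun [set: T] (fun t => h t B)) ->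
  compact K -> measurable (h @^-1` K).
Proof.
move=> mh cK.
have mi i : measurable (h @^-1` half_space i).
  have := @measurable_bc_integral R W d T h mh (box_test a i.1.1 i.1.2).
  move=> /(_ (fun w => (andP (box_bump01 a i.1.1 i.1.2 w)).1)) mI.
  rewrite /half_space; case: i.2 => q [] /=.
    have := mI measurableT _ (@measurable_itv R `]-oo, (ratr q)[).
    by rewrite setTI; congr measurable; apply/seteqP; split => t /=; rewrite in_itv.
  have := mI measurableT _ (@measurable_itv R `](ratr q), +oo[).
  by rewrite setTI; congr measurable; apply/seteqP; split => t /=; rewrite in_itv /= andbT.
have ml l : measurable (h @^-1` half_space_union l).
  rewrite (_ : _ @^-1` _ = \bigcup_i (if i \in l then h @^-1` half_space i else set0)).
    apply: countable_bigcupT_measurable => [|i]; first exact: countableP.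
    by case: ifPn => _ //; exact: mi.
  apply/seteqP; split=> [t [i il it]|t [i _]]; first by exists i; rewrite ?il.
  by case: ifPn => // il it; exists i.
rewrite -[_ @^-1` _]setCK; apply: measurableC.
(* The complement of [K] is the union of the complements of the finite unions containing [K]. Lists
   of indices are countable, so this union is countable. *)
rewrite (_ : ~` _ = \bigcup_l (if `[< K `<=` half_space_union l >]
    then ~` (h @^-1` half_space_union l) else set0)).
  apply: countable_bigcupT_measurable => [|l]; first exact: countableP.
  by case: ifPn => _ //; exact: measurableC.
apply/seteqP; split=> [t /(compact_half_space_union cK)[l [Kl tl]]|t [l _]].
  by exists l => //; rewrite asboolT.
by case: ifPn => // /asboolP Kl tl Kt; apply: tl; exact: Kl.
Qed.

End weak_topology.

(** * Measurability of evaluations and of Borel subsets of products *)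

Section evaluation.
Context {R : realType} {W : completeMetricType R}.
Variable a : nat -> W.
Hypothesis dense_a : forall w r, 0 < r -> exists i, mdist w (a i) < r.

(** The Borel sets with measurable evaluation form a lambda-system. It contains the boxes, whose
    measures are limits of test integrals, hence all that this pi-system generates. *)
Lemma measurable_prob_eval d (T : measurableType d) (k : T -> borel_prob W) :
  (forall phi, measurable_fun [set: T] (fun t => bc_integral (k t) phi)) ->
  forall B : set W, borel_set B -> measurable_fun [set: T] (fun t => k t B).
Proof.
move=> mk; rewrite (borel_set_basic_box dense_a).
pose H := [set B : set W | borel_set B /\ measurable_fun [set: T] (fun t => k t B)].
suff : <<s range (basic_box a)>> `<=` H by move=> h B /h [].
apply: lambda_system_subset => //.
- exact: setI_closed_basic_box.
- apply/dynkin_lambda_system; split.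
  + split; first exact: (@measurableT _ (borelType W)).
    rewrite (_ : (fun t => _) = cst 1%E)//.
    by apply/funext => t; exact: probability_setT.
  + move=> B [bB mB]; split; first exact: borel_setC.
    rewrite (_ : (fun t => _) = (fun t => 1 - k t B)%E); last first.
      by apply/funext => t; exact: (@probability_setC _ (borelType W)).
    exact: emeasurable_funB.
  + move=> F tF HF; split; first by apply: borel_bigcup => i; have [] := HF i.
    rewrite (_ : (fun t => _) = (fun t => \sum_(0 <= i <oo) k t (F i))%E); last first.
      apply/funext => t; apply: (@measure_semi_bigcup _ R (borelType W) (k t) F) => //.
        by move=> i; have [] := HF i.
      by apply: borel_bigcup => i; have [] := HF i.
    apply: ge0_emeasurable_sum => // i _.
    by have [] := HF i.
- move=> _ [s _ <-]; split.
    by apply: sub_sigma_algebra; exact: open_basic_box.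
  apply: (emeasurable_fun_cvg (fun n t => (bc_integral (k t) (box_test a n s))%:E)).
    by move=> n; apply/measurable_EFinP; exact: mk.
  by move=> t _; exact: bc_integral_box_test_cvg.
Qed.

Lemma measurable_continuous_prob (T : ptopologicalType) (k : T -> borel_prob W) :
  continuous k ->
  forall B : set W, borel_set B -> measurable_fun [set: borelType T] (fun t => k t B).
Proof.
move=> ck; apply: measurable_prob_eval => phi.
apply: continuous_borel_measurable => t.
apply: (@continuous_comp _ _ _ k (fun mu => bc_integral mu phi)); first exact: ck.
exact: bc_integral_continuous.
Qed.

(* The second factor being second countable, the Borel sets of the product are
   in the product of the Borel sigma-algebras. *)
Lemma measurable_image_setX (T : ptopologicalType) (V : set W) (A : set (T * V)) :
  borel_set V -> borel_set A ->
  measurable ((fun x : T * V => (x.1, set_val x.2)) @` A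
    : set (borelType T * borelType W)).
Proof.
move=> bV; pose f := fun x : T * V => (x.1 : borelType T, set_val x.2 : borelType W).
have fI : injective f.
  by move=> [t v] [t' v'] [-> /val_inj ->].
move: A; apply: (@smallest_sub _ _ _ [set C | measurable (f @` C)]).
- split=> [|C mC|F mF] /=.
  + by rewrite image_set0; exact: measurable0.
  (* Complements are taken relative to the range of [f], which is the measurable rectangle
     [setT]*[V]; injectivity of [f] gives the equality. *)
  + rewrite setTD (_ : f @` (~` C) = (setT `*` V) `\` (f @` C)).
      apply: measurableD => //; apply: measurableX => //; exact: bV.
    apply/seteqP; split=> [_ [x nCx <-]|[t w] [[_ Vw] nC]].
      split; first by split => //=; exact: set_valP.
      by move=> [y Cy /fI xy]; apply: nCx; rewrite -xy.
    exists (t, exist _ w (mem_set Vw)) => // Ct.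
    by apply: nC; exists (t, exist _ w (mem_set Vw)).
  + by rewrite image_bigcup; exact: bigcupT_measurable.
move=> Q oQ /=.
(* [O p] is the largest open set whose product with the trace of the ball [p] on [V] lies in [Q];
   these countably many rectangles exhaust [Q]. *)
pose O p := [set t | forall v : V, basic_ball a p (set_val v) -> Q (t, v)]^°.
rewrite (_ : f @` Q = \bigcup_p (O p `*` (V `&` basic_ball a p))).
  apply: countable_bigcupT_measurable => [|p]; first exact: countableP.
  apply: measurableX; first by apply: sub_sigma_algebra; exact: open_interior.
  apply: measurableI; first exact: bV.
  by apply: sub_sigma_algebra; exact: open_basic_ball.
apply/seteqP; split=> [_ [[t v] Qtv <-]|[t w] [p _ [/= /interior_subset Ot [Vw wp]]]].
  have : nbhs (t, v) Q by exact: open_nbhs_nbhs.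
  move=> [[A B] [/= At [_ [[B' oB' <-] B'v B'B]]] ABQ].
  have [p vp pB'] := nbhs_basic_ball dense_a (open_nbhs_nbhs (conj oB' B'v)).
  exists p => //; split=> /=; last by split => //; exact: set_valP.
  apply: filterS At => t' At' v' v'p.
  by apply: (ABQ (t', v')); split => //=; apply: B'B => /=; exact: pB'.
by exists (t, exist _ w (mem_set Vw)) => //; exact: (Ot (exist _ w (mem_set Vw))).
Qed.

End evaluation.

(** * Borel measurability of the pushforward map *)

Section pushforward.
Context {R : realType} {W : completeMetricType R}.
Context (N : set (borel_prob W)) (V : set W) (bV : borel_set V).
Hypothesis NV : forall eta, N eta -> eta V = 1%E.

Lemma pushE (g : borel_map (N * V)%type W) eta (B : set W) : borel_set B ->
  push bV NV g eta B = set_val eta (set_val @` [set v : V | B (g (eta, v))]).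
Proof. by move=> bB; rewrite /push /= /push_fun asboolT. Qed.

Lemma borel_slice (A : set (N * V)) (eta : N) : borel_set A ->
  borel_set (set_val @` [set v : V | A (eta, v)]).
Proof.
move=> bA; apply: borel_image_val => //.
have cv : continuous (fun v : V => (eta, v)).
  move=> v; apply: (@cvg_pair _ _ _ (nbhs v) (nbhs eta) (nbhs v)) => /=.
    exact: (@cvg_cst N eta V (nbhs v)).
  exact: cvg_id.
exact: (continuous_borel cv bA).
Qed.

Variable a : nat -> W.
Hypothesis dense_a : forall w r, 0 < r -> exists i, mdist w (a i) < r.

Lemma push_borel (N' : set (borel_prob W)) (g : borel_map (N * V)%type W) :
  compact N' -> (forall eta, N' (push bV NV g eta)) ->
  borel_fun (push bV NV g).
Proof.
(* An empty [N] is treated apart, since the measurable type built on [N] must be pointed. *)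
move=> cN' gN'; have [[x0]|N0] := pselect (inhabited N); last first.
  move=> B _; rewrite (_ : _ @^-1` B = set0).
    by case: (@sigma_algebra_borel N).
  by apply/seteqP; split=> // x; exfalso; apply: N0.
pose T : ptopologicalType := HB.pack (set_type N) (isPointed.Build (set_type N) x0).
have ck : continuous (set_val : T -> borel_prob W) by exact: initial_continuous.
have mpush B : borel_set B ->
    measurable_fun [set: borelType T] (fun t : T => push bV NV g t B).
  move=> bB.
  have mA := measurable_image_setX dense_a bV (borel_mapP g bB) (T := T).
  have := measurable_prob_xsection (measurable_continuous_prob dense_a ck) mA.
  congr measurable_fun; apply/funext => t; rewrite pushE//; congr (set_val t _).
  apply/seteqP; split=> [w /set_mem[[t' v] Bv [<- <-]]|_ [v Bv <-]].
    by exists v.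
  by apply/mem_set; exists (t, v).
have mK (K : set (borel_prob W)) : compact K ->
    borel_set ((push bV NV g : N -> _) @^-1` K).
  exact: (measurable_preimage_compact dense_a mpush).
apply: (@smallest_sub _ _ _ [set B | borel_set ((push bV NV g : N -> _) @^-1` B)]).
- split=> [|A bA|F bF] /=.
  + by rewrite preimage_set0; case: (@sigma_algebra_borel N).
  + by rewrite setTD preimage_setC; exact: borel_setC.
  + by rewrite preimage_bigcup; exact: borel_bigcup.
- move=> U oU /=.
  rewrite (_ : _ @^-1` U = ~` (push bV NV g @^-1` (N' `&` ~` U))).
    apply: borel_setC; apply: mK; exact: (@compact_closedI (borel_prob W) N' (~` U) cN' (open_closedC oU)).
  by apply/seteqP; split=> [t Ut [_]//|t /not_andP[/(_ (gN' t))//|/contrapT]].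
Qed.

End pushforward.

(** * Deviation in probability and the Lévy-Prokhorov distance *)

Section deviation.
Context {R : realType} {W : completeMetricType R}.
Variable a : nat -> W.
Hypothesis dense_a : forall w r, 0 < r -> exists i, mdist w (a i) < r.

Lemma open_mdist_gt (b : W) (r : R) : open [set w | r < mdist w b].
Proof.
apply: (@open_comp _ _ (fun w => mdist w b) [set x | r < x]); last exact: open_gt.
by move=> w _; exact: mdist_continuousl.
Qed.

(** The strict inequality is witnessed by a point [a i] close to [g1 x] and still far from [g2 x],
    so countably many preimages of open sets under [g1] and [g2] separately suffice. *)
Lemma borel_mdist_gt (T : topologicalType) (g1 g2 : borel_map T W) (e : R) :
  borel_set [set x | e < mdist (g1 x) (g2 x)].
Proof.
rewrite (_ : mkset _ = \bigcup_i \bigcup_n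
    (g1 @^-1` (basic_ball a (i, n)) `&`
     g2 @^-1` [set w | e + n.+1%:R^-1 < mdist w (a i)])).
  apply: borel_bigcup => i; apply: borel_bigcup => n.
  apply: borel_setI; apply: borel_mapP; apply: sub_sigma_algebra.
    exact: open_basic_ball.
  exact: open_mdist_gt.
apply/seteqP; split=> [x /= ex|x [i _ [n _ [/= x1 x2]]]].
  (* Half the excess over [e], because the error [n.+1%:R^-1] is spent twice: in the triangle
     inequality and in the raised threshold. *)
  have d0 : 0 < (mdist (g1 x) (g2 x) - e) / 2 by rewrite divr_gt0// subr_gt0.
  have [n _ /(_ n (leqnn _)) /= nd] := near_infty_natSinv_lt (PosNum d0).
  have [i xi] := @dense_a (g1 x) n.+1%:R^-1 ltac:(by rewrite invr_gt0).
  exists i => //; exists n => //; split => //=.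
  have := metric_triangle (g1 x) (a i) (g2 x).
  rewrite (metric_sym (a i)) => tri.
  have h : mdist (g1 x) (a i) < (mdist (g1 x) (g2 x) - e) / 2 := lt_trans xi nd.
  by move: n.+1%:R^-1 nd h => q nd h; lra.
have := metric_triangle (a i) (g1 x) (g2 x).
rewrite (metric_sym (a i) (g1 x)) (metric_sym (a i) (g2 x)).
move: x1 x2; rewrite /basic_ball /=.
by move: (mdist _ _) (mdist _ _) (mdist _ _) (_^-1) => p q u v; lra.
Qed.

(** The infimum need not be attained, so the thickening is written as a countable intersection of
    open enlargements of radius slightly above [e]. *)
Lemma borel_thickening (K : set W) (e : R) : borel_set (thickening K e).
Proof.
rewrite (_ : thickening K e = ~` \bigcup_n
    ~` [set w | exists2 k, K k & mdist w k < e + n.+1%:R^-1]).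
  apply: borel_setC; apply: borel_bigcup => n; apply: borel_setC.
  apply: sub_sigma_algebra.
  rewrite (_ : mkset _ = \bigcup_(k in K) [set w | mdist w k < e + n.+1%:R^-1]).
    apply: bigcup_open => k _.
    apply: (@open_comp _ _ (fun w => mdist w k) [set r | r < e + n.+1%:R^-1]).
      by move=> w _; exact: mdist_continuousl.
    exact: open_lt.
  by apply/seteqP; split=> [w [k Kk wk]|w [k Kk wk]]; exists k.
rewrite setC_bigcup; apply/seteqP; split=> [w /= we n _|w /= we].
  rewrite setCK.
  have /ereal_inf_lt[_ [k Kk <-]] :
      (ereal_inf [set (mdist w k)%:E | k in K] < (e + n.+1%:R^-1)%:E)%E.
    by rewrite (le_lt_trans we)// lte_fin ltrDl invr_gt0.
  by rewrite lte_fin => wk; exists k.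
apply/lee_addgt0Pr => r r0.
have [n _ /(_ n (leqnn _)) /= nr] := near_infty_natSinv_lt (PosNum r0).
have := we n I; rewrite setCK => -[k Kk wk].
apply: (@le_trans _ _ (mdist w k)%:E).
  by apply: ereal_inf_lbound; exists k.
by rewrite -EFinD lee_fin ltW// (lt_trans wk)// ltrD2l.
Qed.

Context (N : set (borel_prob W)) (V : set W) (bV : borel_set V).
Hypothesis NV : forall eta, N eta -> eta V = 1%E.
Implicit Types g : borel_map (N * V)%type W.

Definition deviation g1 g2 (e : R) (eta : N) : R := fine (set_val eta
  (set_val @` [set v : V | e < mdist (g1 (eta, v)) (g2 (eta, v))])).

Lemma borel_deviation g1 g2 e eta :
  borel_set (set_val @` [set v : V | e < mdist (g1 (eta, v)) (g2 (eta, v))]).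
Proof.
exact: (borel_slice bV (A := [set x | e < mdist (g1 x) (g2 x)]) eta (borel_mdist_gt g1 g2 e)).
Qed.

Lemma deviationE g1 g2 e eta : (deviation g1 g2 e eta)%:E =
  set_val eta (set_val @` [set v : V | e < mdist (g1 (eta, v)) (g2 (eta, v))]).
Proof. by rewrite fineK//; apply: fin_num_measure; exact: borel_deviation. Qed.

Lemma deviation01 g1 g2 e eta : 0 <= deviation g1 g2 e eta <= 1.
Proof.
rewrite -!lee_fin deviationE measure_ge0 /=.
by apply: probability_le1; exact: borel_deviation.
Qed.

Lemma deviation_le_sup g1 g2 e eta :
  deviation g1 g2 e eta <= sup_deviation g1 g2 e.
Proof.
apply: sup_upper_bound; last by exists eta.
split; first by exists (deviation g1 g2 e eta), eta.
by exists 1 => _ [eta' _ <-]; have /andP[] := deviation01 g1 g2 e eta'.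
Qed.

Lemma sup_deviation_ge0 g1 g2 e : 0 <= sup_deviation g1 g2 e.
Proof.
have [[eta]|N0] := pselect (inhabited N).
  rewrite (le_trans _ (deviation_le_sup g1 g2 e eta))//.
  by have /andP[] := deviation01 g1 g2 e eta.
rewrite /sup_deviation (_ : image _ _ = set0) ?sup0//.
by apply/seteqP; split=> // x [eta]; exfalso; exact: N0.
Qed.

Lemma deviationC g1 g2 e eta : deviation g1 g2 e eta = deviation g2 g1 e eta.
Proof.
by congr (fine (set_val eta (_ @` _))); apply/funext => v /=; rewrite metric_sym.
Qed.

(** When [g1] lands in [K], either [g2] is within [e <= r] of that point and lands in the
    thickening, or the argument belongs to the deviation set. *)
Lemma push_thickening_le g1 g2 (e r : R) eta (K : set W) : closed K ->
  e <= r -> deviation g1 g2 e eta <= r ->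
  (push bV NV g1 eta K <= push bV NV g2 eta (thickening K r) + r%:E)%E.
Proof.
move=> cK er devr.
have bK : borel_set K.
  by rewrite -[K]setCK; apply: borel_setC; apply: sub_sigma_algebra; exact: closed_openC.
have bT := borel_thickening K r.
rewrite !pushE//.
have b1 := borel_slice bV eta (borel_mapP g1 bK).
have b2 := borel_slice bV eta (borel_mapP g2 bT).
have bd := borel_deviation g1 g2 e eta.
apply: (@le_trans _ _ (set_val eta (set_val @` [set v : V | thickening K r (g2 (eta, v))] `|`
    set_val @` [set v : V | (e < mdist (g1 (eta, v)) (g2 (eta, v)))%R]))%E).
  apply: le_measure; rewrite ?inE//; first exact: borel_setU.
  move=> _ [v Kv <-]; have [le|lt] := leP (mdist (g1 (eta, v)) (g2 (eta, v))) e.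
    left; exists v => //=; apply: (@le_trans _ _ (mdist (g2 (eta, v)) (g1 (eta, v)))%:E).
      by apply: ereal_inf_lbound; exists (g1 (eta, v)).
    by rewrite lee_fin metric_sym (le_trans le).
  by right; exists v.
apply: (le_trans (@measureU2 _ (borelType W) R (set_val eta) _ _ b2 bd)).
apply: leeD2l; rewrite -lee_fin in devr; apply: le_trans devr.
by rewrite deviationE.
Qed.

Lemma LPdist_push_le g1 g2 (e r : R) eta : 0 <= r -> e <= r ->
  deviation g1 g2 e eta <= r ->
  LPdist (push bV NV g1 eta) (push bV NV g2 eta) <= r.
Proof.
move=> r0 er devr; apply: ge_inf; first by exists 0 => x [].
split => // K cK; split; first exact: (push_thickening_le cK er).
by apply: (push_thickening_le cK er); rewrite deviationC.
Qed.

Lemma sum_half_powers n : \sum_(1 <= l < n.+1) (2 ^- l : R) = 1 - 2 ^- n.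
Proof.
elim: n => [|n ih]; first by rewrite big_geq// expr0 invr1 subrr.
by rewrite big_nat_recr//= ih exprS invfM; lra.
Qed.

(** The terms are nonnegative and bounded by [2 ^- k], so the partial sums increase to a genuine
    limit, which dominates each term. *)
Lemma prob_dist_ge_term g1 g2 l : (0 < l)%N ->
  2 ^- l * (sup_deviation g1 g2 (2 ^- l) / (1 + sup_deviation g1 g2 (2 ^- l)))
    <= prob_dist g1 g2.
Proof.
move=> l0.
pose u l := 2 ^- l * (sup_deviation g1 g2 (2 ^- l) / (1 + sup_deviation g1 g2 (2 ^- l))).
have s1 k : 0 < 1 + sup_deviation g1 g2 (2 ^- k).
  by rewrite ltr_pwDl// sup_deviation_ge0.
have u0 k : 0 <= u k.
  by rewrite mulr_ge0// ?invr_ge0 ?exprn_ge0// divr_ge0 ?sup_deviation_ge0// ltW.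
have ule k : u k <= 2 ^- k.
  rewrite ler_piMr ?invr_ge0 ?exprn_ge0// ler_pdivrMr// mul1r.
  by rewrite lerDr.
pose S n := \sum_(1 <= k < n) u k.
have ndS : nondecreasing_seq S.
  apply/nondecreasing_seqP => -[|n]; first by rewrite /S !big_geq.
  by rewrite /S (big_nat_recr n.+1)//= lerDl.
have cS : cvgn S.
  apply: nondecreasing_is_cvgn => //; exists 1 => _ [n _ <-].
  rewrite (le_trans (ndS _ _ (leqnSn n)))// /S.
  rewrite (le_trans (ler_sum _ (fun k _ => ule k)))// sum_half_powers.
  by rewrite lerBlDr lerDl invr_ge0 exprn_ge0.
rewrite (_ : prob_dist g1 g2 = limn S)//.
apply: (le_trans _ (nondecreasing_cvgn_le ndS cS l.+1)).
by rewrite /S big_nat_recr//= lerDr sumr_ge0.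
Qed.

End deviation.

Theorem theorem1p1 (R : realType) (W : completeMetricType R)
    (sepW : separable W) (N N' : set (borel_prob W))
    (cN : compact N) (cN' : compact N')
    (V : set W) (bV : borel_set V)
    (NV : forall eta : borel_prob W, N eta -> eta V = 1%E) :
  exists F : borel_map_push N' bV NV -> borel_map_prob N N',
    (forall (g : borel_map_push N' bV NV) (eta : N),
       sval (F g) eta = push bV NV (sval g) eta) /\
    (forall e : R, 0 < e -> exists2 delta : R, 0 < delta &
       forall g1 g2 : borel_map_push N' bV NV,
         prob_dist (sval g1) (sval g2) < delta ->
         LP_unif_dist (sval (F g1)) (sval (F g2)) < e).
Proof.
have [a dense_a] := separable_dense_seq sepW.
pose F (g : borel_map_push N' bV NV) : borel_map_prob N N' :=
  exist _ (BorelMap (push_borel dense_a cN' (svalP g))) (svalP g).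
exists F; split=> // e e0.
(* A supremum of distances at most [r] is only at most [r]; halving [e] restores the strict
   inequality. *)
pose r := e / 2; have r0 : 0 < r by rewrite divr_gt0.
have [l l0 lr] : exists2 l, (0 < l)%N & (2 ^- l : R) <= r.
  have [n _ /(_ n (leqnn _)) /= nr] := near_infty_natSinv_lt (PosNum r0).
  exists n.+1 => //; apply: le_trans (ltW nr).
  by rewrite lef_pV2 ?posrE ?exprn_gt0// -natrX ler_nat ltnW// ltn_expl.
have r1 : 0 < 1 + r by rewrite addr_gt0.
(* As [t / (1 + t)] is strictly increasing for [t >= 0], a term of index [l] below this value forces
   the supremum of deviations below [r]. *)
exists (2 ^- l * (r / (1 + r))).
  by rewrite mulr_gt0 ?invr_gt0 ?exprn_gt0// divr_gt0.
move=> g1 g2 /(le_lt_trans (prob_dist_ge_term dense_a bV (sval g1) (sval g2) l0)).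
have s0 := sup_deviation_ge0 dense_a bV (sval g1) (sval g2) (2 ^- l).
set s := sup_deviation _ _ _ in s0 *.
have s1 : 0 < 1 + s by rewrite ltr_pwDl.
rewrite ltr_pM2l ?invr_gt0 ?exprn_gt0// ltr_pdivrMr// mulrAC ltr_pdivlMr//.
rewrite !mulrDr !mulr1 (mulrC s) ltrD2r => sr.
apply: (@le_lt_trans _ _ r); last by rewrite /r ltr_pdivrMr// mulr_natr mulr2n ltrDl.
have LPr eta : LPdist (sval (F g1) eta) (sval (F g2) eta) <= r.
  apply: (LPdist_push_le dense_a bV NV (ltW r0) lr).
  exact: le_trans (deviation_le_sup dense_a bV _ _ _ _) (ltW sr).
rewrite /LP_unif_dist; have [[eta]|N0] := pselect (inhabited N).
  apply: ge_sup => [|_ [eta' _ <-]]; last exact: LPr.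
  by exists (LPdist (sval (F g1) eta) (sval (F g2) eta)), eta.
(* For empty [N] the supremum is that of the empty set, which is 0 by convention. *)
rewrite (_ : image _ _ = set0) ?sup0 ?ltW//.
by apply/seteqP; split=> // x [eta]; exfalso; exact: N0.
Qed.
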